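(* Let $d\ge 2$, $c>0$ and $A>0$. There exists a constant $C>0$, depending only on $d$, $c$ and $A$, such that for every odd prime power $q$ and every set $E\subset\mathbb{F}_q^d$ with $\#E\ge c\,q^{d/2}$ and $$|\sigma_E^2(m)|\le A\,q^{-\left(\frac d2+1\right)}\qquad\text{for all } m\in\mathbb{F}_q^d,$$ one has $\#\Delta(E)\ge C\,q$.
   Context: $\mathbb{F}_q$ is the finite field with $q$ elements. For $x\in\mathbb{F}_q^d$, $|x|^2=x_1^2+\dots+x_d^2\in\mathbb{F}_q$, and $\Delta(E)=\{|x-y|^2: x,y\in E\}\subset\mathbb{F}_q$. Fix a nontrivial additive character $\chi$ of $\mathbb{F}_q$ (for $q$ prime, $\chi(t)=e^{2\pi i t/q}$). Then $\widehat{E}(m)=q^{-d}\sum_{x\in E}\chi(-x\cdot m)$ for $m\in\mathbb{F}_q^d$, with $x\cdot m=\sum_j x_jm_j$, and $$\sigma_E^2(m)=\sum_{\{m'\in\mathbb{F}_q^d:\ |m'|^2=|m|^2\}}|\widehat{E}(m')|^2 .$$ *)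

(* Defs.v *)
From HB Require Import structures.
From mathcomp Require Import all_boot all_order all_algebra.
From mathcomp Require Import complex.
From mathcomp Require Import reals exp.
Set Implicit Arguments.
Unset Strict Implicit.
Unset Printing Implicit Defensive.
Import Order.TTheory GRing.Theory Num.Theory.
Local Open Scope ring_scope.

Section FiniteFieldGeometry.
Variables (F : finFieldType) (d : nat).

Definition dotp (x y : 'rV[F]_d) : F := \sum_(j < d) x 0 j * y 0 j.

(* The quadratic form |x|^2 itself, with values in F; it is not a norm. *)
Definition sqlen (x : 'rV[F]_d) : F := \sum_(j < d) x 0 j ^+ 2.

Definition distance_set (E : {set 'rV[F]_d}) : {set F} :=
  [set sqlen (x - y) | x in E, y in E].

End FiniteFieldGeometry.

Section FourierTransform.
Variables (R : realType) (F : finFieldType).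

(* A homomorphism from (F, +) to the multiplicative group of the complex
   numbers R[i]; as F is finite, its values are automatically roots of unity. *)
Definition additive_character (chi : F -> R[i]) : Prop :=
  chi 0 = 1 /\ forall s t : F, chi (s + t) = chi s * chi t.

Definition nontrivial_character (chi : F -> R[i]) : Prop :=
  exists t : F, chi t != 1.

Variables (chi : F -> R[i]) (d : nat) (E : {set 'rV[F]_d}).

Definition fourier (m : 'rV[F]_d) : R[i] :=
  (#|F|%:R ^+ d)^-1 * \sum_(x in E) chi (- dotp x m).

(* [normc] is the complex modulus as an element of R; the generic norm of
   R[i] takes its values in R[i]. *)
Definition sigma2 (m : 'rV[F]_d) : R :=
  \sum_(m' : 'rV[F]_d | sqlen m' == sqlen m)
     ComplexField.Normc.normc (fourier m') ^+ 2.

End FourierTransform.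

(* Main.v *)
Require Import Defs.
From mathcomp Require Import all_boot all_order all_algebra.
From mathcomp Require Import complex.
From mathcomp Require Import reals exp.
From mathcomp Require Import ring zify.
Import Order.TTheory GRing.Theory Num.Theory.
Local Open Scope ring_scope.

(** Write q = #|F|, and for t in F let nu(t) be the number of pairs (x, y) in
    E * E with |x - y|^2 = t.  By Cauchy-Schwarz
      |E|^4 = (sum_t nu(t))^2 <= |Delta(E)| sum_t nu(t)^2,
    so it is enough to bound sum_t nu(t)^2 by a constant times |E|^4 / q.
    Parseval on the additive group of F gives
      q sum_t nu(t)^2 = sum_s |N(s)|^2,
      N(s) = sum_(x, y in E) chi(s |x - y|^2)
    (lemma [sqr_card_le_image]), and s = 0 contributes exactly |E|^4.

    For s != 0, completing the square (lemma [quadratic_sum_vec]) says that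
    m |-> chi(u |m|^2) has Fourier transform g(u)^d chi(- |z|^2 / 4u), with g(u)
    the quadratic Gauss sum.  Expanding the squared modulus of the Fourier
    coefficients of E, this turns the sums N into sums over spheres in
    frequency space (lemma [spectrum_quadratic_sum]): with
      S(r) = sum_(|m|^2 = r) |sum_(x in E) chi(- x.m)|^2,
      sum_r S(r) chi(u r) = g(u)^d N(- 1 / 4u).
    Since |g(u)|^2 = q and u |-> - 1 / 4u permutes the nonzero elements, a second
    use of Parseval on F gives
      q^d sum_(s != 0) |N(s)|^2 <= q sum_r S(r)^2
    (lemma [sum_distance_sum_le]).

    Finally S(|m|^2) = q^(2d) sigma_E^2(m) <= A q^(3d/2 - 1), so that
    sum_(s != 0) |N(s)|^2 <= A^2 q^(2d), and q^(2d) <= |E|^4 / c^4 by the lower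
    bound on |E|.  Altogether q |E|^4 <= |Delta(E)| (1 + A^2 / c^4) |E|^4, and
    C = 1 / (1 + A^2 / c^4) works. *)

(** * Preliminaries on finite fields and finite sums *)

(** The sum of all elements of F is invariant under translation by 1. *)
Lemma card_finField_eq0 (F : finFieldType) : #|F|%:R = 0 :> F.
Proof.
have shift : \sum_(x : F) x = \sum_(x : F) (x + 1).
  by rewrite (reindex_inj (addIr 1)).
by move: shift; rewrite big_split /= sumr_const -{1}[LHS]addr0 => /addrI <-.
Qed.

Lemma odd_card_two_neq0 (F : finFieldType) : odd #|F| -> 2%:R != 0 :> F.
Proof.
move=> oddF; apply/eqP => two0.
have := card_finField_eq0 F.
rewrite -[#|F|]odd_double_half oddF -muln2 natrD natrM two0 mulr0 addr0.
by move/eqP; rewrite oner_eq0.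
Qed.

Lemma card_finField_gt0 (K : numDomainType) (F : finFieldType) : 0 < #|F|%:R :> K.
Proof. by rewrite ltr0n; apply/card_gt0P; exists 0. Qed.

(** Cauchy-Schwarz against the constant 1, obtained by summing
    2 a_i a_j <= a_i^2 + a_j^2 over all pairs. *)
Lemma sqr_sum_le_card (I : finType) (D : {set I}) (a : I -> nat) :
  ((\sum_(i in D) a i) ^ 2 <= #|D| * \sum_(i in D) a i ^ 2)%N.
Proof.
rewrite -(leq_pmul2l (m := 2)) //.
have -> : (2 * (\sum_(i in D) a i) ^ 2
           = \sum_(i in D) \sum_(j in D) 2 * (a i * a j))%N.
  rewrite -mulnn big_distrlr big_distrr /=; apply: eq_bigr => i _.
  by rewrite big_distrr.
have -> : (2 * (#|D| * \sum_(i in D) a i ^ 2)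
           = \sum_(i in D) \sum_(j in D) (a i ^ 2 + a j ^ 2))%N.
  under [RHS]eq_bigr => i _ do rewrite big_split /= sum_nat_const.
  by rewrite big_split /= -big_distrr sum_nat_const mul2n addnn.
by apply: leq_sum => i _; apply: leq_sum => j _; apply: (nat_Cauchy (a i) (a j)).
Qed.

(** * Additive characters and Parseval's identity *)

Section Characters.
Variables (C : numClosedFieldType) (F : finFieldType) (chi : F -> C).
Hypotheses (chi0 : chi 0 = 1) (chiD : forall s t, chi (s + t) = chi s * chi t).

Lemma char_mulN t : chi t * chi (- t) = 1.
Proof. by rewrite -chiD subrr. Qed.

Lemma char_neq0 t : chi t != 0.
Proof.
by apply/eqP => t0; move/eqP: (char_mulN t); rewrite t0 mul0r eq_sym oner_eq0.
Qed.

(** Translation by t permutes F, hence multiplies the product of all values of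
    chi, which is nonzero, both by 1 and by chi t ^+ #|F|: the values of chi are
    roots of unity. *)
Lemma char_norm t : `|chi t| = 1.
Proof.
have prod_neq0 : \prod_(s : F) chi s != 0.
  by apply/prodf_neq0 => s _; apply: char_neq0.
have chiX : chi t ^+ #|F| = 1.
  apply: (mulIf prod_neq0); rewrite mul1r [RHS](reindex_inj (addrI t)) /=.
  under [RHS]eq_bigr => s _ do rewrite chiD.
  by rewrite big_split /= prodr_const.
have qgt0 : (0 < #|F|)%N by apply/card_gt0P; exists 0.
by apply/eqP; rewrite -(pexpr_eq1 qgt0) // -normrX chiX normr1.
Qed.

Lemma char_conj t : (chi t)^* = chi (- t).
Proof.
apply: (mulfI (char_neq0 t)).
by rewrite char_mulN -normCK char_norm expr1n.
Qed.

Lemma char_sum (I : Type) (r : seq I) (f : I -> F) :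
  chi (\sum_(i <- r) f i) = \prod_(i <- r) chi (f i).
Proof. exact: (big_morph chi chiD chi0). Qed.

Lemma sqr_norm_sum (I : finType) (P : pred I) (f : I -> C) :
  `|\sum_(i | P i) f i| ^+ 2 = \sum_(i | P i) \sum_(j | P j) f i * (f j)^*.
Proof. by rewrite normCK rmorph_sum big_distrlr. Qed.

Hypothesis chi_nontrivial : exists t, chi t != 1.

Lemma char_orthogonality a :
  \sum_(u : F) chi (u * a) = if a == 0 then #|F|%:R else 0.
Proof.
case: eqVneq => [->|a0].
  under eq_bigr => u _ do rewrite mulr0 chi0.
  by rewrite sumr_const.
have [t ct] := chi_nontrivial.
(* Translating u by t / a multiplies the sum by chi t. *)
have inv : \sum_(u : F) chi (u * a) = chi t * \sum_(u : F) chi (u * a).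
  rewrite {1}(reindex_inj (addrI (t / a))) /= big_distrr /=.
  by apply: eq_bigr => u _; rewrite mulrDl divfK // chiD.
apply/eqP; move/eqP: inv; rewrite -subr_eq0 -{1}[X in X - _]mul1r -mulrBl.
by rewrite mulf_eq0 subr_eq0 eq_sym (negPf ct).
Qed.

Lemma parseval (f : F -> C) :
  \sum_u `|\sum_r f r * chi (u * r)| ^+ 2 = #|F|%:R * \sum_r `|f r| ^+ 2.
Proof.
under eq_bigr => u _ do rewrite sqr_norm_sum.
rewrite exchange_big big_distrr /=; apply: eq_bigr => r _.
rewrite exchange_big (bigD1 r) //= [X in _ + X]big1 ?addr0 => [|s sr].
  under eq_bigr => u _.
    rewrite rmorphM /= mulrACA -normCK -normCK char_norm expr1n mulr1; over.
  by rewrite sumr_const mulr_natl.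
under eq_bigr => u _.
  rewrite rmorphM /= mulrACA char_conj -chiD -mulrBr; over.
by rewrite -big_distrr /= char_orthogonality subr_eq0 eq_sym (negPf sr) mulr0.
Qed.

(** A function phi that spreads P evenly over F has small exponential sums for
    u != 0; conversely, control of these sums forces a large image.  The proof
    is Cauchy-Schwarz on the sizes of the fibres of phi, whose sum of squares
    is given by Parseval. *)
Lemma sqr_card_le_image (I : finType) (P : {set I}) (phi : I -> F) :
  #|F|%:R * #|P|%:R ^+ 2
    <= #|phi @: P|%:R * \sum_u `|\sum_(p in P) chi (u * phi p)| ^+ 2.
Proof.
pose nu t := #|[set p in P | phi p == t]|.
have nuE (G : F -> C) : \sum_(p in P) G (phi p) = \sum_t (nu t)%:R * G t.
  rewrite (partition_big phi predT) //=; apply: eq_bigr => t _.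
  rewrite (eq_bigr (fun=> G t)) => [|p /andP[_ /eqP->] //].
  by rewrite sumr_const mulr_natl /nu cardsE.
under eq_bigr => u _ do rewrite (nuE (fun t => chi (u * t))).
rewrite parseval [leRHS]mulrCA ler_pM2l ?card_finField_gt0 //.
have cardP : #|P| = (\sum_(t in phi @: P) nu t)%N.
  rewrite -sum1_card (partition_big phi (mem (phi @: P))) /=; last first.
    by move=> p Pp; apply: imset_f.
  by apply: eq_bigr => t _; rewrite sum1_card /nu cardsE.
have le1 := sqr_sum_le_card _ (phi @: P) nu.
rewrite -cardP in le1.
have le2 : (\sum_(t in phi @: P) nu t ^ 2 <= \sum_t nu t ^ 2)%N.
  by rewrite [leqRHS](bigID (mem (phi @: P))) leq_addr.
have := leq_trans le1 (leq_mul (leqnn _) le2).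
rewrite -(ler_nat C) natrX natrM natr_sum.
by under eq_bigr => t _ do rewrite natrX -[X in X ^+ _]normr_nat.
Qed.

(** * Quadratic Gauss sums *)

Hypothesis two_neq0 : 2%:R != 0 :> F.

Definition gauss_sum u := \sum_(t : F) chi (u * t ^+ 2).

(** After the substitution t = s + h the square s^2 cancels in t^2 - s^2, so the
    sum over s is linear, and orthogonality leaves only h = 0 because 2u is
    invertible. *)
Lemma gauss_sum_norm u : u != 0 -> `|gauss_sum u| ^+ 2 = #|F|%:R.
Proof.
move=> u0; rewrite sqr_norm_sum exchange_big /=.
transitivity (\sum_(s : F) \sum_(h : F) chi (u * h ^+ 2) * chi (s * (2%:R * u * h))).
  apply: eq_bigr => s _; rewrite (reindex_inj (addrI s)) /=.
  by apply: eq_bigr => h _; rewrite char_conj -!chiD; congr chi; ring.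
rewrite exchange_big /=; under eq_bigr => h _ do rewrite -big_distrr char_orthogonality /=.
rewrite (bigD1 0) //= big1 ?addr0 => [|h h0].
  by rewrite !mulr0 eqxx expr0n mulr0 chi0 mul1r.
by rewrite !mulf_eq0 (negPf two_neq0) (negPf u0) (negPf h0) mulr0.
Qed.

Lemma quadratic_sum u z : u != 0 ->
  \sum_(t : F) chi (u * t ^+ 2 + t * z)
    = gauss_sum u * chi (- (4%:R * u)^-1 * z ^+ 2).
Proof.
move=> u0; rewrite /gauss_sum big_distrl /=.
(* This shift completes the square. *)
rewrite (reindex_inj (addIr (- (z / (2%:R * u))))) /=.
apply: eq_bigr => t _; rewrite -chiD; congr chi; field.
by rewrite u0 (natrM _ 2 2) mulf_neq0 two_neq0.
Qed.

Variable d : nat.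

(** The Fourier transform of a Gaussian is a Gaussian: both the quadratic form
    and the pairing split over coordinates, so the sum is the product of d
    one-dimensional sums. *)
Lemma quadratic_sum_vec u (z : 'rV[F]_d) : u != 0 ->
  \sum_(m : 'rV[F]_d) chi (u * sqlen m + dotp z m)
    = gauss_sum u ^+ d * chi (- (4%:R * u)^-1 * sqlen z).
Proof.
move=> u0.
transitivity (\sum_(f : {ffun 'I_d -> F})
                \prod_j chi (u * f j ^+ 2 + f j * z 0 j)).
  rewrite (reindex (fun f : {ffun 'I_d -> F} => \row_j f j)) /=; last first.
    exists (fun m : 'rV[F]_d => [ffun j => m 0 j]) => m _.
      by apply/ffunP => j; rewrite ffunE mxE.
    by apply/rowP => j; rewrite mxE ffunE.
  apply: eq_bigr => f _; rewrite -char_sum /sqlen /dotp big_distrr -big_split /=.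
  by congr chi; apply: eq_bigr => j _; rewrite mxE [z 0 j * _]mulrC.
rewrite -(bigA_distr_bigA (fun j t => chi (u * t ^+ 2 + t * z 0 j))) /=.
under eq_bigr => j _ do rewrite (quadratic_sum u _ u0).
rewrite big_split /= prodr_const card_ord -char_sum.
by rewrite /sqlen big_distrr.
Qed.

(** * From distances to spherical sums of the spectrum *)

Variable E : {set 'rV[F]_d}.

Definition distance_sum s :=
  \sum_(p in setX E E) chi (s * sqlen (p.1 - p.2)).

(** The Fourier coefficients are left unnormalised here, so that no division by
    a power of #|F| occurs before the comparison with [sigma2]. *)
Definition spectrum m := `|\sum_(x in E) chi (- dotp x m)| ^+ 2.

Definition spherical_spectrum r := \sum_(m | sqlen m == r) spectrum m.

(** Grouping the frequencies m by |m|^2 gives the sum of chi(u |m|^2) against the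
    spectrum; the spectrum at m is a sum over pairs (x, y) of chi((x - y).m), and
    summing over m first gives the transform of a Gaussian at x - y. *)
Lemma spectrum_quadratic_sum u : u != 0 ->
  \sum_r spherical_spectrum r * chi (u * r)
    = gauss_sum u ^+ d * distance_sum (- (4%:R * u)^-1).
Proof.
move=> u0.
transitivity (\sum_m spectrum m * chi (u * sqlen m)).
  rewrite [RHS](partition_big (fun m => sqlen m) predT) //=.
  apply: eq_bigr => r _; rewrite big_distrl /=.
  by apply: eq_bigr => m /eqP ->.
rewrite /distance_sum big_distrr /=.
under [RHS]eq_bigr => p _ do rewrite -quadratic_sum_vec //.
rewrite exchange_big /=; apply: eq_bigr => m _.
rewrite /spectrum sqr_norm_sum exchange_big pair_big /= big_distrl /=.
apply: eq_big => [[x y]|[x y] _] /=; first by rewrite in_setX.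
rewrite char_conj opprK -!chiD; congr chi; rewrite [LHS]addrC; congr (_ + _).
by rewrite addrC /dotp -sumrN -big_split /=; apply: eq_bigr => j _; rewrite !mxE; ring.
Qed.

(** The substitution s = - 1 / 4u turns the left side into
    the sum over u != 0 of |sum_r S(r) chi(u r)|^2, with S the spherical spectrum,
    because |gauss_sum u ^+ d|^2 = q^d.  Adding the term u = 0 makes Parseval
    applicable. *)
Lemma sum_distance_sum_le :
  #|F|%:R ^+ d * \sum_(s | s != 0) `|distance_sum s| ^+ 2
    <= #|F|%:R * \sum_r spherical_spectrum r ^+ 2.
Proof.
have four0 : 4%:R != 0 :> F by rewrite (natrM _ 2 2) mulf_neq0.
(* It is an involution of the whole of F because 0^-1 = 0. *)
have invol : involutive (fun s : F => - (4%:R * s)^-1).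
  by move=> s; rewrite mulrN !invrN opprK invfM invrK mulKf.
rewrite (reindex_inj (inv_inj invol)) big_distrr /=.
have sph_ge0 r : 0 <= spherical_spectrum r.
  by apply: sumr_ge0 => m _; rewrite exprn_ge0.
under [X in _ <= _ * X]eq_bigr => r _ do rewrite -(ger0_norm (sph_ge0 r)).
rewrite -parseval [leRHS](bigID (fun u => u != 0)) /= -[leLHS]addr0.
apply: lerD; last by apply: sumr_ge0 => u _; rewrite exprn_ge0.
under eq_bigl => u do rewrite oppr_eq0 invr_eq0 mulf_eq0 (negPf four0) /=.
rewrite le_eqVlt; apply/orP; left; apply/eqP; apply: eq_bigr => u u0.
rewrite spectrum_quadratic_sum // normrM normrX exprMn -exprM mulnC exprM.
by rewrite gauss_sum_norm.
Qed.

(** [sqr_card_le_image] for the distance map on pairs of points of E, in which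
    the zero frequency contributes |E|^4. *)
Lemma distance_set_energy :
  #|F|%:R ^+ d.+1 * #|E|%:R ^+ 4
    <= #|distance_set E|%:R
       * (#|F|%:R ^+ d * #|E|%:R ^+ 4
          + #|F|%:R * \sum_r spherical_spectrum r ^+ 2).
Proof.
have -> : distance_set E = (fun p => sqlen (p.1 - p.2)) @: setX E E.
  apply/setP => t; apply/imset2P/imsetP => [[x y Ex Ey ->]|[[x y]]].
    by exists (x, y); rewrite // in_setX Ex.
  by rewrite in_setX => /andP[Ex Ey] ->; exists x y.
have := sqr_card_le_image _ (setX E E) (fun p => sqlen (p.1 - p.2)).
rewrite cardsX natrM -expr2 -exprM -/distance_sum (bigD1 0) //=.
have -> : \sum_(p in setX E E) chi (0 * sqlen (p.1 - p.2)) = #|E|%:R ^+ 2.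
  under eq_bigr => p _ do rewrite mul0r chi0.
  by rewrite sumr_const cardsX natrM expr2.
rewrite normrX normr_nat -exprM => energy.
have qd : 0 < #|F|%:R ^+ d :> C by rewrite exprn_gt0 ?card_finField_gt0.
rewrite -(ler_pM2l qd) in energy.
rewrite exprSr -mulrA; apply: le_trans energy _.
rewrite [leLHS]mulrCA ler_wpM2l ?ler0n // mulrDr lerD2l.
exact: sum_distance_sum_le.
Qed.
End Characters.

(** * The bound in terms of sigma_E^2 *)

Lemma normc_normr (R : rcfType) (z : R[i]) : (ComplexField.Normc.normc z)%:C%C = `|z|.
Proof. by rewrite normc_def; case: z. Qed.

Lemma spherical_spectrumE (R : realType) (F : finFieldType) (chi : F -> R[i])
    (d : nat) (E : {set 'rV[F]_d}) (m : 'rV[F]_d) :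
  spherical_spectrum _ _ chi d E (sqlen m)
    = (#|F|%:R ^+ d.*2 * sigma2 chi E m)%:C%C.
Proof.
have q0C : #|F|%:R != 0 :> R[i] by rewrite gt_eqF ?card_finField_gt0.
rewrite rmorphM rmorph_sum rmorphXn rmorph_nat big_distrr /=.
apply: eq_bigr => m' _; rewrite rmorphXn /= normc_normr /fourier normrM.
rewrite normfV normrX normr_nat exprMn mulrA exprVn -exprM -mul2n mulnC divff ?mul1r //.
by rewrite expf_neq0.
Qed.

(** The bound B is only assumed at the values taken by |m|^2; at the other
    elements of F the sphere is empty and its spectrum vanishes.  The exponent
    comes from q^(1-d) sum_r S(r)^2 <= q^(1-d) q (q^(2d) B)^2. *)
Lemma distance_set_sigma2 (R : realType) (F : finFieldType) (chi : F -> R[i])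
    (d : nat) (E : {set 'rV[F]_d}) (B : R) :
  odd #|F| -> additive_character chi -> nontrivial_character chi ->
  0 <= B -> (forall m, sigma2 chi E m <= B) ->
  #|F|%:R * #|E|%:R ^+ 4
    <= #|distance_set E|%:R * (#|E|%:R ^+ 4 + #|F|%:R ^+ (3 * d + 2) * B ^+ 2).
Proof.
move=> oddF [chi0 chiD] chi1 B0 sB.
have q0 : 0 < #|F|%:R :> R := card_finField_gt0 _ _.
have sph_le r : spherical_spectrum _ _ chi d E r <= (#|F|%:R ^+ d.*2 * B)%:C%C.
  case: (pickP (fun m : 'rV[F]_d => sqlen m == r)) => [m /eqP <-|none].
    by rewrite spherical_spectrumE lecR ler_wpM2l // exprn_ge0 // ltW.
  rewrite /spherical_spectrum big_pred0 // ler0c.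
  by rewrite mulr_ge0 // exprn_ge0 // ltW.
have sph_ge0 r : 0 <= spherical_spectrum _ _ chi d E r.
  by apply: sumr_ge0 => m _; rewrite exprn_ge0.
have sum_le : \sum_r spherical_spectrum _ _ chi d E r ^+ 2
    <= (#|F|%:R * (#|F|%:R ^+ d.*2 * B) ^+ 2)%:C%C.
  rewrite rmorphM rmorph_nat rmorphXn /= mulr_natl -sumr_const.
  by apply: ler_sum => r _; rewrite lerXn2r ?nnegrE // (le_trans (sph_ge0 r)).
have le1 : #|F|%:R ^+ d.+1 * #|E|%:R ^+ 4
    <= #|distance_set E|%:R * (#|F|%:R ^+ d * #|E|%:R ^+ 4
         + #|F|%:R * (#|F|%:R * (#|F|%:R ^+ d.*2 * B) ^+ 2)) :> R.
  have two0 := odd_card_two_neq0 _ oddF.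
  move: (#|F|%:R * _ ^+ 2) sum_le => S sum_le.
  rewrite -lecR !(rmorphM, rmorphD, rmorphXn, rmorph_nat) /=.
  apply: le_trans (distance_set_energy _ _ _ chi0 chiD chi1 two0 _ E) _.
  by rewrite ler_wpM2l ?ler0n // lerD2l ler_wpM2l ?ler0n.
rewrite -(ler_pM2l (exprn_gt0 d q0)) mulrA -exprSr.
apply: le_trans le1 _; rewrite [leRHS]mulrCA ler_wpM2l ?ler0n // mulrDr lerD2l.
have -> : (3 * d + 2 = d + d + d + 2)%N by lia.
rewrite -addnn le_eqVlt; apply/orP; left; apply/eqP.
by rewrite !exprD; ring.
Qed.

Theorem corollary1p12 (R : realType) (d : nat) (c A : R) :
  (2 <= d)%N -> 0 < c -> 0 < A ->
  exists C : R, 0 < C /\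
    forall (F : finFieldType) (chi : F -> R[i]) (E : {set 'rV[F]_d}),
      odd #|F| ->
      additive_character chi -> nontrivial_character chi ->
      c * #|F|%:R `^ (d%:R / 2) <= #|E|%:R ->
      (forall m : 'rV[F]_d,
         `|sigma2 chi E m| <= A * #|F|%:R `^ (- (d%:R / 2 + 1))) ->
      C * #|F|%:R <= #|distance_set E|%:R.
Proof.
move=> _ c0 A0; have c4 : 0 < c ^+ 4 by rewrite exprn_gt0.
have K0 : 0 < 1 + A ^+ 2 / c ^+ 4.
  by rewrite addr_gt0 // divr_gt0 // exprn_gt0.
exists (1 + A ^+ 2 / c ^+ 4)^-1; split; first by rewrite invr_gt0.
move=> F chi E oddF chiP chi1 largeE sigma_le.
set q : R := #|F|%:R; have q0 : 0 < q := card_finField_gt0 _ _.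
set p := q `^ (d%:R / 2); have p0 : 0 < p by rewrite powR_gt0.
have p2 : p ^+ 2 = q ^+ d.
  by rewrite /p -powR_mulrn ?powR_ge0 // -powRrM divfK ?pnatr_eq0 // powR_mulrn // ltW.
have pq : q `^ (- (d%:R / 2 + 1)) = (p * q)^-1.
  by rewrite powRN powRD ?(powRr1 (ltW q0)) // (gt_eqF q0) implybT.
have B0 : 0 <= A / (p * q) by rewrite ltW // divr_gt0 // mulr_gt0.
have sB m : sigma2 chi E m <= A / (p * q).
  by rewrite -pq; apply: le_trans (ler_norm _) (sigma_le m).
have := distance_set_sigma2 _ _ _ _ E _ oddF chiP chi1 B0 sB.
rewrite -/q; set e : R := #|E|%:R; set D : R := #|distance_set E|%:R.
have e0 : 0 < e by apply: lt_le_trans largeE; rewrite mulr_gt0.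
(* Here p = q^(d/2), so q^(3d+2) = p^6 q^2. *)
have -> : q ^+ (3 * d + 2) * (A / (p * q)) ^+ 2 = A ^+ 2 * p ^+ 4.
  by rewrite exprD mulnC exprM -p2; field; rewrite !gt_eqF.
have ep : p ^+ 4 <= e ^+ 4 / c ^+ 4.
  rewrite ler_pdivlMr // -exprMn mulrC lerXn2r ?nnegrE ?(ltW e0) //.
  by rewrite ltW ?mulr_gt0.
move=> bound; rewrite mulrC ler_pdivrMr //.
rewrite -(ler_pM2r (exprn_gt0 4 e0)); apply: le_trans bound _.
rewrite -[leRHS]mulrA ler_wpM2l ?ler0n // mulrDl mul1r lerD2l.
by rewrite -[leRHS]mulrA ler_wpM2l ?exprn_ge0 ?(ltW A0) // mulrC.
Qed.
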